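(* Let $n\ge 1$ and let $P_n$ be the path on $n$ vertices. Then $$\operatorname{th}_+(P_n)=\left\lceil \sqrt{2n}-\tfrac12\right\rceil .$$
   Context: All graphs are finite, simple and undirected. Positive semidefinite (PSD) color change rule: each vertex of $G$ is blue or white; let $B$ be the current set of blue vertices and let $W_1,\dots,W_k$ be the vertex sets of the connected components of $G-B$. A white vertex $w\in W_i$ is colored blue (is forced by the blue vertex $v$) when $w$ is the only white neighbor of $v$ in the induced subgraph $G[W_i\cup B]$. Starting with exactly the vertices of $S\subseteq V(G)$ blue, at each time step all possible forces are performed simultaneously. $S$ is a PSD zero forcing set if eventually all vertices become blue; in that case $\operatorname{pt}_+(G;S)$ is the number of time steps needed to color all vertices blue (so it is $0$ if $S=V(G)$), and otherwise $\operatorname{pt}_+(G;S)=\infty$. Define $\operatorname{th}_+(G;S)=|S|+\operatorname{pt}_+(G;S)$, and the PSD throttling number $\operatorname{th}_+(G)=\min\{\operatorname{th}_+(G;S): S \text{ is a PSD zero forcing set of } G\}$. *)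

(* Defs.v *)
From HB Require Import structures.
From mathcomp Require Import all_boot all_order all_algebra.
From mathcomp Require Import boolp reals.

Set Implicit Arguments.
Unset Strict Implicit.
Unset Printing Implicit Defensive.

Record sgraph := SGraph {
  vertex :> finType;
  adj : rel vertex;
  adj_sym : symmetric adj;
  adj_irr : irreflexive adj
}.

Section PathGraph.
Variable n : nat.

Definition path_adj : rel 'I_n :=
  fun i j => (i.+1 == j :> nat) || (j.+1 == i :> nat).

Lemma path_adj_sym : symmetric path_adj.
Proof. by move=> i j; rewrite /path_adj orbC. Qed.

Lemma path_adj_irr : irreflexive path_adj.
Proof. by move=> i; rewrite /path_adj orbb eqn_leq ltnn. Qed.

Definition path_graph : sgraph := SGraph path_adj_sym path_adj_irr.

End PathGraph.

Section PSDForcing.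
Variable G : sgraph.
Implicit Types (A B S W : {set G}) (v w : G).

Definition induced_adj A : rel G :=
  fun x y => [&& x \in A, y \in A & adj x y].

(* The vertex sets of the connected components of the induced graph G[A]. *)
Definition components A : {set {set G}} :=
  equivalence_partition (connect (induced_adj A)) A.

(* White means "not in B". *)
Definition psd_forces B W v w : bool :=
  (v \in B) && ([set x in ~: B | induced_adj (W :|: B) v x] == [set w]).

Definition psd_step B : {set G} :=
  B :|: [set w | [exists W in components (~: B),
                    (w \in W) && [exists v, psd_forces B W v w]]].

Definition psd_blue S (t : nat) : {set G} := iter t psd_step S.

Definition psd_zf_set S : Prop := exists t, psd_blue S t == setT.

(* [None] stands for infinity. *)
Definition psd_pt S : option nat :=
  if pselect (psd_zf_set S) is left h then Some (ex_minn h) else None.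

Definition psd_th_at S : option nat := omap (addn #|S|) (psd_pt S).

Lemma psd_th_at_ex : exists k, [exists S, psd_th_at S == Some k].
Proof.
have h : psd_zf_set [set: G] by exists 0.
case E : (psd_pt [set: G]) => [t|]; last first.
  by move: E; rewrite /psd_pt; case: pselect.
by exists (#|[set: G]| + t); apply/existsP; exists setT; rewrite /psd_th_at E.
Qed.

Definition psd_th : nat := ex_minn psd_th_at_ex.

End PSDForcing.

(* Main.v *)
Require Import Defs.
From mathcomp Require Import all_boot all_order all_algebra.
From mathcomp Require Import boolp reals zify ring lra.

Set Implicit Arguments.
Unset Strict Implicit.
Unset Printing Implicit Defensive.

(** On a path, a blue vertex [v] separates its two neighbours, so two white
    neighbours of [v] lie in different components of the white subgraph and
    [v] forces both.  Conversely a forced vertex is always adjacent to a blue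
    one.  Hence one time step replaces the blue set by its closed neighbourhood
    ([psd_step_path]), and after [t] steps the blue set is the union of the
    balls of radius [t] around the initial vertices ([psd_blue_path]).

    Throttling a path is thus a covering problem: [s] vertices and [t] steps
    suffice for some choice of the [s] vertices exactly when [s] balls of at
    most [2t+1] vertices each can cover the path, that is when
    [n <= s (2t+1)] ([card_path_nbhd], [path_nbhd_cover]).  Put [k = s + t].
    The identity [k (k+1) - 2 s (2t+1) = (s-t) (s-t-1)] has a right-hand side
    that is a product of two consecutive integers; so it is nonnegative, and it vanishes
    for [s = ceil (k/2)], [t = floor (k/2)].  Therefore the throttling number is
    the least [k] with [2n <= k (k+1)] ([psd_th_path_ge], [psd_th_path_le]).
    Since both sides are integers, it may be relaxed to [2n <= (k + 1/2)^2],
    that is, to [sqrt (2n) - 1/2 <= k] ([sqrt_sub_half_le]), whose least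
    solution is the ceiling. *)

(** * Throttling in an arbitrary graph *)

Section Throttling.
Variable G : sgraph.
Implicit Types A S : {set G}.

Lemma induced_adj_sym A : symmetric (induced_adj A).
Proof. by move=> x y; rewrite /induced_adj adj_sym andbCA. Qed.

(** This is what makes [components A] a partition of [A]. *)
Lemma connect_induced_equiv A :
  {in A & &, equivalence_rel (connect (induced_adj A))}.
Proof.
have cs : connect_sym (induced_adj A) by apply/sym_connect_sym/induced_adj_sym.
by move=> x y z _ _ _; split=> // xy; rewrite (same_connect cs xy).
Qed.

Lemma psd_th_leq S t : psd_blue S t = setT -> psd_th G <= #|S| + t.
Proof.
move=> St; have zfS : psd_zf_set S by exists t; rewrite St.
case E : (psd_pt S) => [p|]; last by move: E; rewrite /psd_pt; case: pselect.
have le_pt : p <= t.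
  move: E; rewrite /psd_pt; case: pselect => // h [<-].
  by case: ex_minnP => m _; apply; rewrite St.
rewrite /psd_th; case: ex_minnP => m _ min_m.
apply: (@leq_trans (#|S| + p)); last by rewrite leq_add2l.
by apply: min_m; apply/existsP; exists S; rewrite /psd_th_at E.
Qed.

Lemma psd_th_attained :
  exists S, exists2 t, psd_blue S t = setT & psd_th G = #|S| + t.
Proof.
rewrite /psd_th; case: ex_minnP => m /existsP[S /eqP thS] _.
exists S; move: thS; rewrite /psd_th_at /psd_pt.
case: pselect => // h /= [<-].
by case: ex_minnP => t /eqP St _; exists t.
Qed.

End Throttling.

(** * Forcing on a path *)

Section PathForcing.
Variable n : nat.
Local Notation P := (path_graph n).
Implicit Types (B S : {set P}) (u v w : P).

Definition path_ball t v : {set P} :=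
  [set w : P | ((v : 'I_n) <= (w : 'I_n) + t) && ((w : 'I_n) <= (v : 'I_n) + t)].

Definition path_nbhd t S : {set P} := \bigcup_(v in S) path_ball t v.

Lemma path_nbhdP t S w :
  reflect (exists2 v, v \in S & w \in path_ball t v) (w \in path_nbhd t S).
Proof. exact: bigcupP. Qed.

(** White vertices joined by a white walk lie on the same side of each blue
    vertex, since a walk in a path cannot jump over a vertex. *)
Lemma connect_same_side B v u w : v \in B ->
  connect (induced_adj (~: B)) u w ->
  ((u : 'I_n) < (v : 'I_n)) = ((w : 'I_n) < (v : 'I_n)).
Proof.
move=> vB; apply: (@closed_connect _ _ [pred x : P | (x : 'I_n) < (v : 'I_n)]).
move=> x y; rewrite /induced_adj !inE => /and3P[xB yB].
have xv : (x : 'I_n) != (v : 'I_n) :> nat.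
  by apply: contraNneq xB => /val_inj ->.
have yv : (y : 'I_n) != (v : 'I_n) :> nat.
  by apply: contraNneq yB => /val_inj ->.
rewrite /= /path_adj; lia.
Qed.

(** The component certifying the force is that of [w]: any other white
    neighbour of the blue neighbour [v] is on the other side of [v]. *)
Lemma psd_step_path B : psd_step B = path_nbhd 1 B.
Proof.
apply/setP => w; apply/idP/path_nbhdP.
  rewrite !inE => /orP[wB|]; first by exists w => //; rewrite inE; lia.
  case/existsP=> W /and3P[_ _ /existsP[v /andP[vB /eqP/setP/(_ w)]]].
  rewrite in_set1 eqxx inE => /andP[_ /and3P[_ _ vw]].
  by exists v => //; move: vw; rewrite inE /= /path_adj; lia.
case=> v vB; rewrite inE => vw; rewrite !inE.
case: (boolP (w \in B)) => //= wB; apply/existsP.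
have wv : (w : 'I_n) != (v : 'I_n) :> nat.
  by apply: contraNneq wB => /val_inj ->.
have eqv := @connect_induced_equiv P (~: B).
have parB := equivalence_partitionP eqv.
have wC : w \in ~: B by rewrite inE.
have inW u : u \in ~: B -> (u \in pblock (components (~: B)) w)
                          = connect (induced_adj (~: B)) w u.
  by move=> uC; rewrite pblock_equivalence_partition.
exists (pblock (components (~: B)) w); apply/and3P; split.
- by rewrite pblock_mem // (cover_partition parB).
- by rewrite mem_pblock (cover_partition parB).
apply/existsP; exists v; rewrite /psd_forces vB; apply/eqP/setP => x.
rewrite inE in_set1; apply/andP/eqP => [[xC]|->].
  rewrite /induced_adj !in_setU vB orbT /= => /andP[].
  have xB : (x \in B) = false by apply/negbTE; move: xC; rewrite inE.
  rewrite xB orbF inW // => /(connect_same_side vB).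
  move=> side vx; apply: val_inj; move: vx side vw wv; rewrite /path_adj /=.
  lia.
split=> //; rewrite /induced_adj !in_setU vB orbT inW // connect0 /= /path_adj.
by move: vw wv => /=; lia.
Qed.

Lemma path_nbhd0 S : path_nbhd 0 S = S.
Proof.
apply/setP => w; apply/path_nbhdP/idP => [[v vS]|wS]; last first.
  by exists w => //; rewrite inE; lia.
rewrite inE => vw; suff -> : w = v by [].
by apply: val_inj; move: vw => /=; lia.
Qed.

Lemma path_nbhdS t S : path_nbhd 1 (path_nbhd t S) = path_nbhd t.+1 S.
Proof.
apply/setP => w; apply/path_nbhdP/path_nbhdP => [[u /path_nbhdP[v vS]]|[v vS]].
  by rewrite !inE => vu uw; exists v => //; rewrite inE; lia.
rewrite inE => vw.
have [vwt|vwt] := boolP (w \in path_ball t v).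
  by exists w; [apply/path_nbhdP; exists v|rewrite inE; lia].
(* The intermediate vertex is one step from [w] towards [v]. *)
pose i := if (v : 'I_n) < (w : 'I_n) then (w : 'I_n).-1 else (w : 'I_n).+1.
have ltin : i < n.
  by move: (ltn_ord v) (ltn_ord w) vwt; rewrite /i inE; case: ifP; lia.
exists (Ordinal ltin : P); last by rewrite inE /= /i; case: ifP; lia.
apply/path_nbhdP; exists v => //; move: vw vwt; rewrite !inE /= /i.
by case: ifP; lia.
Qed.

Lemma psd_blue_path S t : psd_blue S t = path_nbhd t S.
Proof.
elim: t => [|t IHt]; first by rewrite path_nbhd0.
by rewrite /psd_blue iterS -/(psd_blue S t) IHt psd_step_path path_nbhdS.
Qed.

Lemma card_path_ball t v : #|path_ball t v| <= t.*2.+1.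
Proof.
pose f w : 'I_(t.*2.+1) := inord ((w : 'I_n) + t - (v : 'I_n)).
rewrite -[leqRHS]card_ord -(@card_in_imset _ _ f) ?max_card // => x y.
rewrite !inE => xv yv /(congr1 val); rewrite /= !inordK; try lia.
by move=> xy; apply: val_inj => /=; lia.
Qed.

Lemma card_path_nbhd t S : #|path_nbhd t S| <= #|S| * t.*2.+1.
Proof.
rewrite -sum_nat_const /path_nbhd.
elim/big_ind2: _ => [|A a B b Aa Bb|v _]; first by rewrite cards0.
  exact: leq_trans (leq_card_setU _ _) (leq_add Aa Bb).
exact: card_path_ball.
Qed.

(** The [j]-th block of [2t+1] consecutive vertices is covered from its middle
    vertex; truncating the centres at the last vertex keeps them on the path
    and does not uncover anything. *)
Lemma path_nbhd_cover s t : 0 < n -> n <= s * t.*2.+1 ->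
  exists2 S : {set P}, #|S| <= s & path_nbhd t S = setT.
Proof.
move=> n0 ns.
have cP (j : 'I_s) : minn (j * t.*2.+1 + t) n.-1 < n by lia.
pose c j : P := Ordinal (cP j).
exists (c @: setT).
  by rewrite (leq_trans (leq_imset_card _ _)) // cardsT card_ord.
apply/setP => w; rewrite inE; apply/path_nbhdP.
have wn := ltn_ord (w : 'I_n).
have js : (w : 'I_n) %/ t.*2.+1 < s by rewrite ltn_divLR // (leq_trans wn).
exists (c (Ordinal js)); first exact: imset_f.
rewrite inE /=.
have := divn_eq (w : 'I_n) t.*2.+1; have := @ltn_pmod (w : 'I_n) t.*2.+1 isT.
lia.
Qed.

Lemma psd_th_path_ge : n.*2 <= psd_th P * (psd_th P).+1.
Proof.
have [S [t St ->]] := psd_th_attained P.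
have := card_path_nbhd t S; rewrite -psd_blue_path St cardsT card_ord.
move: #|S| => s ns; rewrite -leq_double in ns; apply: leq_trans ns _.
(* The difference of the two sides is [(s - t) (s - t - 1)]: it is [d (d + 1)]
   both for [s = d + t + 1] and for [t = d + s]. *)
have [ts|st] := ltnP t s.
  rewrite -(subnK ts); move: (s - t.+1) => d.
  have -> : (d + t.+1 + t) * (d + t.+1 + t).+1
            = ((d + t.+1) * t.*2.+1).*2 + d * d.+1 by rewrite -!mul2n; ring.
  exact: leq_addr.
rewrite -(subnK st); move: (t - s) => d.
have -> : (s + (d + s)) * (s + (d + s)).+1
          = (s * (d + s).*2.+1).*2 + d * d.+1 by rewrite -!mul2n; ring.
exact: leq_addr.
Qed.

(** Splitting the budget [k] as evenly as possible makes the covering bound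
    [s (2t+1)] equal to [k (k+1) / 2]. *)
Lemma psd_th_path_le k : 0 < n -> n.*2 <= k * k.+1 -> psd_th P <= k.
Proof.
move=> n0 nk.
have [|S Ss St] := @path_nbhd_cover (uphalf k) k./2 n0.
  by have := odd_double_half k; rewrite uphalf_half; case: odd; nia.
have := @psd_th_leq P S k./2; rewrite psd_blue_path => /(_ St) th_le.
apply: leq_trans th_le _.
by have := uphalf_half k; have := odd_double_half k; lia.
Qed.

End PathForcing.

Import Order.TTheory GRing.Theory Num.Theory.
Local Open Scope ring_scope.

(** * From the quadratic inequality to the ceiling *)

(** Squaring turns the left-hand side into [2n <= k (k+1) + 1/4], and both
    [2n] and [k (k+1)] are integers. *)
Lemma sqrt_sub_half_le (R : realType) (n k : nat) :
  (Num.sqrt (2 * n%:R) - 1 / 2 <= k%:R :> R) = (n.*2 <= k * k.+1)%N.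
Proof.
have n0 : 0 <= n%:R :> R by [].
have k0 : 0 <= k%:R :> R by [].
rewrite lerBlDr -(@ler_pXn2r _ 2) ?nnegrE ?sqrtr_ge0 //; last by lra.
rewrite sqr_sqrtr; last by lra.
have -> : (k%:R + 1 / 2) ^+ 2 = (k * k.+1)%:R + 1 / 4 :> R.
  by rewrite natrM -natr1; field.
have -> : 2 * n%:R = (n.*2)%:R :> R by rewrite -mul2n natrM.
move: n.*2 (k * k.+1)%N => a b; have [ab|ba] := leqP a b.
  by have := ab; rewrite -(ler_nat R) => ?; lra.
by have := ba; rewrite -(ler_nat R) -natr1 => ?; lra.
Qed.

Theorem theorem3p2 (R : realType) (n : nat) (hn : (1 <= n)%N) :
  (psd_th (path_graph n))%:Z = Num.ceil (Num.sqrt (2 * n%:R) - 1 / 2 : R).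
Proof.
apply/esym/ceil_def.
have := psd_th_path_ge n; have := fun k => @psd_th_path_le n k hn.
case: (psd_th _) => [|m] th_le th_ge; first by move: th_ge; lia.
rewrite -[(m.+1)%:~R]/(m.+1%:R) sqrt_sub_half_le th_ge andbT.
rewrite -addn1 PoszD addrK ltNge -[m%:~R]/(m%:R) sqrt_sub_half_le.
by apply/negP => /th_le; rewrite ltnn.
Qed.
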